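(* For each non-negative integer $n$, \[ \sum_{k=0}^n \binom {n+k}{k} F_{n+2k+1} = (-1)^{n} - \sum_{k=0}^{n-1} (-1)^{n-k} \binom {2k+1}{k} F_{3(k+2)}, \] \[ \sum_{k=0}^n \binom {n+k}{k} L_{n+2k+1} = (-1)^{n} - \sum_{k=0}^{n-1} (-1)^{n-k} \binom {2k+1}{k} L_{3(k+2)}. \]
   Context: $F_j$ and $L_j$ denote the Fibonacci and Lucas numbers: $F_0=0,F_1=1$, $L_0=2,L_1=1$, both satisfying $X_j=X_{j-1}+X_{j-2}$. *)

(* Defs.v *)
From mathcomp Require Import all_boot all_order all_algebra.

Set Implicit Arguments.
Unset Strict Implicit.
Unset Printing Implicit Defensive.

Fixpoint fib (n : nat) : nat :=
  match n with
  | 0 => 0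
  | 1 => 1
  | (m.+1 as p).+1 => fib p + fib m
  end.

Fixpoint lucas (n : nat) : nat :=
  match n with
  | 0 => 2
  | 1 => 1
  | (m.+1 as p).+1 => lucas p + lucas m
  end.

(* Main.v *)
(** Both identities hold for any integer sequence [G] with the Fibonacci
    recurrence and [G 1 = 1].  Let [S n] be the left-hand side.  By Pascal's rule
    the [k]-th terms of [S n.+1] and [S n] add up to a telescoping difference,
    which gives [S n.+1 + S n = 'C(2n+1, n) G(3(n+2))]; the right-hand side solves
    this first-order recurrence with [S 0 = G 1 = 1]. *)
Require Import Defs.
From mathcomp Require Import all_boot all_order all_algebra.
From mathcomp Require Import zify ring.

Import Order.TTheory GRing.Theory Num.Theory.
Local Open Scope ring_scope.

Lemma sum_bin_gibonacci_telescope (G : nat -> int) (n m : nat) :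
  (forall j, G j.+2 = G j.+1 + G j) ->
  \sum_(0 <= k < m.+1) 'C(n.+1 + k, k)%:Z * G (n.+1 + 2 * k + 1)%N
  + \sum_(0 <= k < m.+1) 'C(n + k, k)%:Z * G (n + 2 * k + 1)%N
  = 'C(n.+1 + m, m)%:Z * G (n + 2 * m + 3)%N.
Proof.
move=> GE; elim: m => [|m IHm].
  rewrite !big_nat1 !bin0 !mul1r.
  have -> : (n.+1 + 2 * 0 + 1 = n.+2)%N by lia.
  have -> : (n + 2 * 0 + 1 = n.+1)%N by lia.
  by have -> : (n + 2 * 0 + 3 = n.+3)%N by lia.
rewrite big_nat_recr //= [in X in _ + X]big_nat_recr //= addrACA IHm.
have -> : (n + 2 * m.+1 + 3 = (n + 2 * m + 3).+2)%N by lia.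
have -> : (n.+1 + 2 * m.+1 + 1 = (n + 2 * m + 3).+1)%N by lia.
have -> : (n + 2 * m.+1 + 1 = n + 2 * m + 3)%N by lia.
have -> : (n.+1 + m = n + m.+1)%N by lia.
(* With [j = n + 2 * m + 3], Pascal's rule merges the two coefficients of [G j] into the coefficient
   of [G j.+1], and the recurrence gives [G j.+2]. *)
rewrite GE addSn binS PoszD; ring.
Qed.

Lemma central_bin_double (n : nat) :
  'C(n.+1 + n.+1, n.+1) = (2 * 'C(2 * n + 1, n))%N.
Proof.
have -> : (n.+1 + n.+1 = (2 * n + 1).+1)%N by lia.
(* The two Pascal summands are equal by symmetry. *)
rewrite binS -(@bin_sub (2 * n + 1) n.+1); last by lia.
have -> : (2 * n + 1 - n.+1 = n)%N by lia.
lia.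
Qed.

(** Telescoping up to [k = n] leaves the top term [k = n.+1], whose coefficient is twice the
    telescoped one; then [G j + 2 * G j.+1 = G j.+3] with [j = 3 * n + 3]. *)
Lemma sum_bin_gibonacciS (G : nat -> int) (n : nat) :
  (forall j, G j.+2 = G j.+1 + G j) ->
  \sum_(0 <= k < n.+2) 'C(n.+1 + k, k)%:Z * G (n.+1 + 2 * k + 1)%N
  + \sum_(0 <= k < n.+1) 'C(n + k, k)%:Z * G (n + 2 * k + 1)%N
  = 'C(2 * n + 1, n)%:Z * G (3 * (n + 2))%N.
Proof.
move=> GE; rewrite big_nat_recr //= addrAC sum_bin_gibonacci_telescope //.
rewrite central_bin_double PoszM.
have -> : (n.+1 + n = 2 * n + 1)%N by lia.
have -> : (n.+1 + 2 * n.+1 + 1 = (n + 2 * n + 3).+1)%N by lia.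
have -> : (3 * (n + 2) = (n + 2 * n + 3).+3)%N by lia.
rewrite !GE; ring.
Qed.

Lemma sum_bin_gibonacci (G : nat -> int) (n : nat) :
  (forall j, G j.+2 = G j.+1 + G j) -> G 1%N = 1 ->
  \sum_(0 <= k < n.+1) 'C(n + k, k)%:Z * G (n + 2 * k + 1)%N
  = (-1) ^+ n
    - \sum_(0 <= k < n)
        (-1) ^+ (n - k) * 'C(2 * k + 1, k)%:Z * G (3 * (k + 2))%N.
Proof.
move=> GE G1; elim: n => [|n IHn].
  by rewrite big_nat1 big_geq // bin0 G1.
apply: (addIr (\sum_(0 <= k < n.+1) 'C(n + k, k)%:Z * G (n + 2 * k + 1)%N)).
rewrite sum_bin_gibonacciS // IHn [in RHS]big_nat_recr //= subSnn.
(* Raising [n] by one flips the sign of every term [k < n], so these sums cancel and only the new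
   term [k = n] survives. *)
rewrite (eq_big_nat _ _ (F2 := fun k => - ((-1) ^+ (n - k) *
  'C(2 * k + 1, k)%:Z * G (3 * (k + 2))%N))); last first.
  by move=> k /andP[_ lt_kn]; rewrite (subSn (ltnW lt_kn)) exprS !mulN1r !mulNr.
rewrite sumrN exprS; ring.
Qed.

Theorem theorem13 (n : nat) :
  (\sum_(0 <= k < n.+1) 'C(n + k, k)%:Z * (fib (n + 2 * k + 1))%:Z
     = (-1) ^+ n
       - \sum_(0 <= k < n)
           (-1) ^+ (n - k) * 'C(2 * k + 1, k)%:Z * (fib (3 * (k + 2)))%:Z)
  /\
  (\sum_(0 <= k < n.+1) 'C(n + k, k)%:Z * (lucas (n + 2 * k + 1))%:Z
     = (-1) ^+ n
       - \sum_(0 <= k < n)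
           (-1) ^+ (n - k) * 'C(2 * k + 1, k)%:Z * (lucas (3 * (k + 2)))%:Z).
Proof.
split.
(* The recurrence and the value at 1 hold by computation. *)
- exact: (sum_bin_gibonacci (fun j => (fib j)%:Z)).
- exact: (sum_bin_gibonacci (fun j => (lucas j)%:Z)).
Qed.
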